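(* Let $(\{v_j\},\{p_j\})$ be a sequential norming pair for $\mathbb{R}$ such that $$p_j\left\lfloor\frac{|v_{j+1}|}{|v_j|}-1\right\rfloor\ge 1\quad\text{for all but finitely many } j,$$ and let $(G_v,\sigma_v)$ be the topological group generated by $(\{v_j\},\{p_j\})$. Then the completion $\mathcal{C}(G_v,\sigma_v)$ is one dimensional, locally totally disconnected, and not locally compact.
   Context: All sequences are indexed by $\mathbb{N}=\{1,2,\dots\}$, and $\lfloor x\rfloor$ is the greatest integer less than or equal to $x$. A sequential norming pair (SNP) for $\mathbb{R}^n$ is a pair $(\{v_j\},\{p_j\})$ where $\{p_j\}$ is a nonincreasing sequence of positive real numbers converging to $0$, and $\{v_j\}$ is a sequence in $\mathbb{R}^n\setminus\{0\}$ such that $\{\|v_j\|\}$ (Euclidean norm) is nondecreasing and $\{p_{j+1}\|v_{j+1}\|/\|v_j\|\}$ has a positive lower bound. The topological group generated by an SNP $(\{v_j\},\{p_j\})$ is $(G_v,\sigma_v)$, where $G_v$ is the subgroup of $\mathbb{R}^n$ generated by $\{v_j\}$ and $\sigma_v(x)=\inf\{\sum |c_j|p_j : x=\sum c_jv_j,\ c_j\in\mathbb{Z}\}$ (finite sums). $\sigma_v$ induces the translation-invariant metric $d(x,y)=\sigma_v(x-y)$ and a metrizable group topology on $G_v$ (known). $\mathcal{C}(G_v,\sigma_v)$ is the completion of $G_v$ as a metric space for $d$, with the group operations extended continuously. These groups are separable metrizable, so all standard dimension functions (small inductive, large inductive, covering) agree; ''dimension'' means any of them. A space is totally disconnected if its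 components are points; a topological group is locally totally disconnected if the identity has a totally disconnected neighborhood. *)

(* Defs.v *)
From mathcomp Require Import all_boot all_order all_algebra.
From mathcomp Require Import all_classical all_reals all_analysis.
Set Implicit Arguments.
Unset Strict Implicit.
Unset Printing Implicit Defensive.
Import Order.TTheory GRing.Theory Num.Theory.
Import numFieldNormedType.Exports.
Local Open Scope classical_set_scope.
Local Open Scope ring_scope.

(* Sequences are indexed from 0 instead of 1: [v j] stands for $v_{j+1}$.
   On the line the Euclidean norm is the absolute value. *)
Record SNP (R : realType) (v p : nat -> R) : Prop := {
  SNP_p_gt0 : forall j, 0 < p j ;
  SNP_p_nonincreasing : nonincreasing_seq p ;
  SNP_p_cvg0 : p @ \oo --> 0 ;
  SNP_v_neq0 : forall j, v j != 0 ;
  SNP_v_nondecreasing : nondecreasing_seq (fun j => `|v j|) ;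
  SNP_ratio : exists2 e : R, 0 < e & forall j, e <= p j.+1 * `|v j.+1| / `|v j|
}.

Definition subgroup_generated (V : zmodType) (A : set V) : set V :=
  smallest [set H : set V | H 0 /\ forall x y, H x -> H y -> H (x - y)] A.

Definition SNP_group (R : realType) (v : nat -> R) : set R :=
  subgroup_generated (range v).

(* Only meaningful on [SNP_group v]: elsewhere the set is empty and the value
   is the default [inf set0 = 0]. *)
Definition SNP_sigma (R : realType) (v p : nat -> R) (x : R) : R :=
  inf [set s | exists (m : nat) (c : nat -> int),
    x = \sum_(j < m) v j *~ c j /\ s = \sum_(j < m) `|c j|%:~R * p j].

(* The library has no join of its metric and topological group structures, so a
   metric group is a [topologicalZmodType] together with a distance inducing its
   topology. *)
Record metrizes (R : realType) (X : topologicalType) (d : X -> X -> R) : Prop := {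
  metrizes_eq0 : forall x y, d x y = 0 <-> x = y ;
  metrizes_sym : forall x y, d x y = d y x ;
  metrizes_triangle : forall x y z, d x z <= d x y + d y z ;
  metrizes_nbhs : forall (x : X) (U : set X),
    nbhs x U <-> exists2 e : R, 0 < e & [set y | d x y < e] `<=` U
}.

Definition metric_complete (R : realType) (X : topologicalType)
    (d : X -> X -> R) : Prop :=
  forall u : nat -> X,
    (forall e : R, 0 < e ->
       exists N, forall m n, (N <= m)%N -> (N <= n)%N -> d (u m) (u n) < e) ->
    exists l : X, u @ \oo --> l.

(* [i] exhibits [C], with distance [d], as the completion of the group [G] with
   the metric [sigma (x - y)]; since addition and opposite are continuous on [C]
   and [i @` G] is dense, they are the continuous extensions of the operations
   of [G]. Only the values of [i] on [G] matter. *)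
Record is_completion (R : realType) (V : zmodType) (G : set V) (sigma : V -> R)
    (C : topologicalZmodType) (d : C -> C -> R) (i : V -> C) : Prop := {
  completion_metrizes : metrizes d ;
  completion_complete : metric_complete d ;
  completion_additive : forall x y, G x -> G y -> i (x - y) = i x - i y ;
  completion_isometry : forall x y, G x -> G y -> d (i x) (i y) = sigma (x - y) ;
  completion_dense : dense (i @` G)
}.

Definition frontier (X : topologicalType) (A : set X) : set X :=
  closure A `\` interior A.

(* Small inductive dimension, with the index shifted so that the dimension -1
   of the empty space is covered: [ind_lt n X] means $\mathrm{ind} X \le n - 1$.
   The frontier carries the subspace topology. *)
Fixpoint ind_lt (n : nat) (X : topologicalType) : Prop :=
  if n is m.+1 then
    forall (x : X) (U : set X), nbhs x U ->
      exists V : set X,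
        [/\ open V, V x, V `<=` U & ind_lt m (set_type (frontier V))]
  else X -> False.

Definition has_ind (X : topologicalType) (n : nat) : Prop :=
  ind_lt n.+1 X /\ ~ ind_lt n X.

Definition locally_totally_disconnected (G : topologicalZmodType) : Prop :=
  exists2 U : set G, nbhs 0 U & totally_disconnected U.

(* Main.v *)
(* With n_j = floor(|v_{j+1}|/|v_j| - 1) >= 1/p_j, an integer combination of
   cost at most 1 of the late v_j has |c_j| |v_j| <= |v_{j+1}| - |v_j|, so these
   bounds telescope and such expansions are unique. Hence near 0 the norm sigma
   is a weighted l^1 norm sum |c_j| p_j on integer sequences, and the completion
   is locally the corresponding integer l^1 space, much like Erdős's space.
   Prescribing finitely many coordinates gives clopen subsets of small balls,
   which separate points, and which form a base on small spheres because there
   equal norms force small tails; so balls have zero-dimensional frontiers.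
   A walk along successive generators, with steps p_j -> 0, meets the frontier of
   any small open set, so the dimension is not 0. Finally, multiples of distinct
   generators form separated sequences in every neighborhood of 0. *)
Require Import Defs.
From mathcomp Require Import all_boot all_order all_algebra.
From mathcomp Require Import all_classical all_reals all_analysis.
From mathcomp Require Import lra.
Import Order.TTheory GRing.Theory Num.Theory.
Import numFieldNormedType.Exports.
Local Open Scope classical_set_scope.
Local Open Scope ring_scope.

Set Implicit Arguments.
Unset Strict Implicit.
Unset Printing Implicit Defensive.

(** * Finite integer combinations of a sequence of generators *)

Section IntegerCombinations.
Variables (V : zmodType) (w : nat -> V).

Definition comb (m : nat) (c : nat -> int) : V := \sum_(j < m) w j *~ c j.

Definition supported (m : nat) (c : nat -> int) : Prop :=
  forall j, (m <= j)%N -> c j = 0.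

Lemma eq_comb m c c' : (forall j, (j < m)%N -> c j = c' j) ->
  comb m c = comb m c'.
Proof. by move=> h; apply: eq_bigr => j _; rewrite h. Qed.

Lemma combS m c : comb m.+1 c = comb m c + w m *~ c m.
Proof. by rewrite /comb big_ord_recr. Qed.

Lemma comb_widen m m' c : supported m c -> (m <= m')%N -> comb m' c = comb m c.
Proof.
move=> hc; elim: m' => [|m' IH]; first by rewrite leqn0 => /eqP->.
rewrite leq_eqVlt => /orP[/eqP-> //|]; rewrite ltnS => lem.
by rewrite combS hc // mulr0z addr0 IH.
Qed.

Lemma combD m c c' : comb m (c \+ c') = comb m c + comb m c'.
Proof. by rewrite /comb -big_split; apply: eq_bigr => j _; rewrite mulrzDr. Qed.

Lemma combN m c : comb m (fun j => - c j) = - comb m c.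
Proof. by rewrite /comb -sumrN; apply: eq_bigr => j _; rewrite mulrNz. Qed.

Lemma combB m c c' : comb m (fun j => c j - c' j) = comb m c - comb m c'.
Proof. by rewrite -combN -combD. Qed.

Lemma supportedD m m' c c' : supported m c -> supported m' c' ->
  supported (maxn m m') (c \+ c').
Proof.
by move=> h h' j; rewrite geq_max => /andP[le le']; rewrite /= h // h'.
Qed.

Lemma supportedN m c : supported m c -> supported m (fun j => - c j).
Proof. by move=> h j le; rewrite h // oppr0. Qed.

(** [comb m c] ignores [c] from [m] on, so truncating allows combinations of different lengths to be
    rewritten at a common length. *)
Definition truncate (m : nat) (c : nat -> int) : nat -> int :=
  fun j => if (j < m)%N then c j else 0.

Lemma truncate_supported m c : supported m (truncate m c).
Proof. by move=> j; rewrite /truncate leqNgt => /negbTE->. Qed.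

Lemma truncateE m c j : (j < m)%N -> truncate m c j = c j.
Proof. by rewrite /truncate => ->. Qed.

Lemma comb_truncate m m' c : (m <= m')%N ->
  comb m' (truncate m c) = comb m c.
Proof.
move=> /(comb_widen (@truncate_supported m c)) ->.
by apply: eq_comb => j; exact: truncateE.
Qed.

Lemma comb1 m k n : (k < m)%N ->
  comb m (fun j => if j == k then n else 0) = w k *~ n.
Proof.
move=> km; rewrite /comb (bigD1 (Ordinal km)) //= eqxx big1 ?addr0 // => j.
by rewrite -val_eqE /= => /negbTE->.
Qed.

End IntegerCombinations.

(** * The weighted l^1 cost of a coefficient sequence *)

Section Cost.
Variables (R : realType) (p : nat -> R).
Hypothesis p_gt0 : forall j, 0 < p j.

Definition cost (m : nat) (c : nat -> int) : R :=
  \sum_(j < m) `|c j|%:~R * p j.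

Lemma eq_cost m c c' : (forall j, (j < m)%N -> c j = c' j) ->
  cost m c = cost m c'.
Proof. by move=> h; apply: eq_bigr => j _; rewrite h. Qed.

Lemma costS m c : cost m.+1 c = cost m c + `|c m|%:~R * p m.
Proof. by rewrite /cost big_ord_recr. Qed.

Lemma cost_widen m m' c : supported m c -> (m <= m')%N -> cost m' c = cost m c.
Proof.
move=> hc; elim: m' => [|m' IH]; first by rewrite leqn0 => /eqP->.
rewrite leq_eqVlt => /orP[/eqP-> //|]; rewrite ltnS => lem.
by rewrite costS hc // normr0 mul0r addr0 IH.
Qed.

Lemma cost_truncate m m' c : (m <= m')%N ->
  cost m' (truncate m c) = cost m c.
Proof.
move=> /(cost_widen (@truncate_supported m c)) ->.
by apply: eq_cost => j; exact: truncateE.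
Qed.

Lemma costN m c : cost m (fun j => - c j) = cost m c.
Proof. by apply: eq_bigr => j _; rewrite normrN. Qed.

Lemma cost_term_ge0 m (c : nat -> int) : 0 <= `|c m|%:~R * p m.
Proof. by rewrite mulr_ge0 ?ler0z // ltW. Qed.

Lemma cost_ge0 m c : 0 <= cost m c.
Proof. by apply: sumr_ge0 => j _; exact: cost_term_ge0. Qed.

Lemma cost_term_le m c j : (j < m)%N -> `|c j|%:~R * p j <= cost m c.
Proof.
move=> jm; rewrite /cost (bigD1 (Ordinal jm)) //= lerDl.
by apply: sumr_ge0 => k _; exact: cost_term_ge0.
Qed.

(** A nonzero integer has absolute value at least 1, so a nonzero [c j] alone would cost [p j]. *)
Lemma cost_lt_eq0 m c j : (j < m)%N -> cost m c < p j -> c j = 0.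
Proof.
move=> jm cp; apply/eqP; apply: contraTT cp => cj; rewrite -leNgt.
apply: le_trans (cost_term_le c jm); rewrite ler_peMl ?(ltW (p_gt0 j)) //.
by rewrite ler1z -gtz0_ge1 normr_gt0.
Qed.

Lemma costD_le m c c' : cost m (c \+ c') <= cost m c + cost m c'.
Proof.
rewrite /cost -big_split; apply: ler_sum => j _ /=.
by rewrite -mulrDl ler_wpM2r ?(ltW (p_gt0 _)) // -intrD ler_int ler_normD.
Qed.

Lemma costB_le m c c' : cost m (fun j => c j - c' j) <= cost m c + cost m c'.
Proof. by rewrite -[cost m c']costN; exact: costD_le. Qed.

(** Disjoint supports leave no cancellation. This exact additivity later separates heads from
    tails. *)
Lemma costD m c c' : (forall j, c j = 0 \/ c' j = 0) ->
  cost m (c \+ c') = cost m c + cost m c'.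
Proof.
move=> h; rewrite /cost -big_split; apply: eq_bigr => j _ /=.
by rewrite -mulrDl; case: (h j) => ->; rewrite normr0 ?add0r ?addr0.
Qed.

Lemma cost1 m k n : (k < m)%N ->
  cost m (fun j => if j == k then n else 0) = `|n|%:~R * p k.
Proof.
move=> km; rewrite /cost (bigD1 (Ordinal km)) //= eqxx big1 ?addr0 // => j.
by rewrite -val_eqE /= => /negbTE->; rewrite normr0 mul0r.
Qed.

End Cost.

(** * The group generated by a norming pair, and uniqueness of cheap expansions *)

Section SequentialNormingPair.
Variables (R : realType) (v p : nat -> R).
Hypothesis hSNP : SNP v p.

Let p_gt0 := SNP_p_gt0 hSNP.

Lemma SNP_comb m c : SNP_group v (comb v m c).
Proof.
move=> H [[H0 HB] vH].
have HN x : H x -> H (- x) by move=> Hx; rewrite -sub0r; exact: HB.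
have HD x y : H x -> H y -> H (x + y).
  by move=> Hx Hy; rewrite -[y]opprK; apply: HB => //; exact: HN.
have Hn x n : H x -> H (x *+ n).
  by move=> Hx; elim: n => [|n IH]; rewrite ?mulr0n // mulrS; exact: HD.
elim: m => [|m IH]; first by rewrite /comb big_ord0.
rewrite combS; apply: HD => //.
have Hv : H (v m) by apply: vH; exists m.
by case: (c m) => n; [exact: Hn | apply: HN; exact: Hn].
Qed.

Lemma SNP_groupP x : SNP_group v x -> exists m c, x = comb v m c.
Proof.
apply: (@smallest_sub _ _ _ [set x | exists m c, x = comb v m c]).
  split; first by exists 0%N, (fun=> 0); rewrite /comb big_ord0.
  move=> _ _ [m [c ->]] [m' [c' ->]].
  exists (maxn m m'), (fun j => truncate m c j - truncate m' c' j).
  by rewrite combB !comb_truncate ?leq_maxl ?leq_maxr.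
move=> _ [k _ <-]; exists k.+1, (fun j => if j == k then 1 else 0).
by rewrite comb1.
Qed.

(** Convertible to the set whose infimum defines [SNP_sigma]. *)
Let costs x := [set s | exists m c, x = comb v m c /\ s = cost p m c].

Let costs_lb x : has_lbound (costs x).
Proof. by exists 0 => _ [m [c [_ ->]]]; exact: cost_ge0. Qed.

Lemma SNP_sigma_le m c : SNP_sigma v p (comb v m c) <= cost p m c.
Proof. by apply: (ge_inf (costs_lb (comb v m c))); exists m, c. Qed.

(** Membership in the group makes the set of costs nonempty, so the infimum is genuine and is
    approached. *)
Lemma SNP_sigma_lt x r : SNP_group v x -> SNP_sigma v p x < r ->
  exists m c, x = comb v m c /\ cost p m c < r.
Proof.
move=> /SNP_groupP[m [c xE]] xr.
have hi : has_inf (costs x).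
  by split; [exists (cost p m c), m, c | exact: costs_lb].
have /(inf_adherent)/(_ hi)[_ [m' [c' [xE' ->]]]] : 0 < r - SNP_sigma v p x.
  by rewrite subr_gt0.
by rewrite [inf _ + _]addrC subrK => ?; exists m', c'.
Qed.

Lemma SNP_norm_neq0 j : 0 < `|v j|.
Proof. by rewrite normr_gt0 (SNP_v_neq0 hSNP). Qed.

Variable N : nat.
Hypothesis growth : forall j, (N <= j)%N ->
  1 <= p j * (Num.floor (`|v j.+1| / `|v j| - 1))%:~R.

(** Cancelling [p j] against the growth hypothesis bounds [|e|] by the floor, hence by the ratio
    minus 1. Multiplying by [|v j|] gives a telescoping term. *)
Lemma growth_step j (e : int) : (N <= j)%N -> `|e|%:~R * p j <= 1 ->
  `|v j *~ e| <= `|v j.+1| - `|v j|.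
Proof.
move=> Nj ep; have v0 := SNP_norm_neq0 j.
have h : `|e|%:~R * p j <= (Num.floor (`|v j.+1| / `|v j| - 1))%:~R * p j.
  by apply: le_trans ep _; rewrite mulrC growth.
have {h} : `|e|%:~R <= `|v j.+1| / `|v j| - 1.
  by apply: le_trans (floor_le_tmp _); rewrite -(ler_pM2r (p_gt0 j)).
rewrite -[v j *~ e]mulrzr normrM -intr_norm => h.
have -> : `|v j.+1| - `|v j| = `|v j| * (`|v j.+1| / `|v j| - 1).
  by rewrite mulrBr mulr1 mulrCA divff ?mulr1 // gt_eqF.
by rewrite ler_pM2l.
Qed.

Lemma comb_bound k (e : nat -> int) : (forall j, (j < N)%N -> e j = 0) ->
  (forall j, (j < k)%N -> `|e j|%:~R * p j <= 1) -> (N <= k)%N ->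
  `|comb v k e| <= `|v k| - `|v N|.
Proof.
move=> e0; elim: k => [|k IH] ep.
  rewrite leqn0 => /eqP->.
  by rewrite /comb big_ord0 normr0 subrr.
rewrite leq_eqVlt => /orP[/eqP<-|].
  rewrite subrr (@eq_comb _ _ _ _ (fun=> 0)); last by move=> j; exact: e0.
  by rewrite /comb big1 ?normr0 // => j _; rewrite mulr0z.
rewrite ltnS => Nk; rewrite combS.
have h1 := IH (fun j jk => ep j (ltnW jk)) Nk.
have h2 := growth_step Nk (ep k (ltnSn k)).
have h3 := ler_normD (comb v k e) (v k *~ e k).
lra.
Qed.

(** If the last coefficient [e k] were nonzero, its term would have size at least [|v k|], while the
    earlier terms that must cancel it total at most [|v k| - |v N|]. So it vanishes, and induction
    descends. *)
Lemma comb_eq0 k e : (forall j, (j < N)%N -> e j = 0) ->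
  (forall j, (j < k)%N -> `|e j|%:~R * p j <= 1) -> comb v k e = 0 ->
  forall j, (j < k)%N -> e j = 0.
Proof.
move=> e0; elim: k => [//|k IH] ep.
have {}IH := IH (fun j jk => ep j (ltnW jk)).
rewrite combS => cE j.
have ek0 : e k = 0.
  have [/e0//|Nk] := ltnP k N.
  have := comb_bound e0 (fun j jk => ep j (ltnW jk)) Nk.
  move/eqP: cE; rewrite addr_eq0 => /eqP->; rewrite normrN -[v k *~ _]mulrzr normrM.
  rewrite -intr_norm => hle.
  apply/eqP; apply/negPn/negP => ek.
  have : 1 <= `|e k|%:~R :> R by rewrite ler1z -gtz0_ge1 normr_gt0.
  rewrite -(ler_pM2l (SNP_norm_neq0 k)) mulr1 => h.
  have := SNP_norm_neq0 N; lra.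
rewrite ltnS leq_eqVlt => /orP[/eqP-> //|]; apply: IH.
by rewrite ek0 mulr0z addr0 in cE.
Qed.

(** An expansion of cost below [p N] has no coefficient before [N], and two expansions of cost below
    1/2 differ by one of cost at most 1. A cheaper expansion would thus coincide with the given
    one. *)
Lemma SNP_sigma_comb rho m c : rho <= p N -> rho <= 1 / 2 ->
  cost p m c < rho -> SNP_sigma v p (comb v m c) = cost p m c.
Proof.
move=> rN r2 cr; apply/eqP; rewrite eq_le SNP_sigma_le /=.
apply: lb_le_inf; first by exists (cost p m c), m, c.
move=> _ [m' [c' [cE ->]]]; rewrite leNgt; apply/negP => c'c.
have c'r : cost p m' c' < rho := lt_trans c'c cr.
pose M := maxn m m'.
pose t := truncate m c; pose t' := truncate m' c'.
have tE : comb v M t = comb v m c by rewrite comb_truncate ?leq_maxl.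
have tE' : comb v M t' = comb v m' c' by rewrite comb_truncate ?leq_maxr.
have tC : cost p M t = cost p m c by rewrite cost_truncate ?leq_maxl.
have tC' : cost p M t' = cost p m' c' by rewrite cost_truncate ?leq_maxr.
have small0 k d j : cost p k d < rho -> (j < N)%N -> truncate k d j = 0.
  rewrite /truncate => dr jN; case: ifPn => // jk.
  apply: (@cost_lt_eq0 _ p p_gt0 k d) => //; apply: lt_le_trans dr _.
  by apply: le_trans rN _; apply: (SNP_p_nonincreasing hSNP); exact: ltnW.
suff h : forall j, (j < M)%N -> t j - t' j = 0.
  have : cost p M t = cost p M t'.
    by apply: eq_cost => j jM; apply/eqP; rewrite -subr_eq0 h.
  by rewrite tC tC' => h'; rewrite h' ltxx in c'c.
apply: comb_eq0.
- by move=> j jN; rewrite /t /t' !small0 ?subrr.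
- move=> j jM.
  apply: le_trans (cost_term_le p_gt0 (fun j => t j - t' j) jM) _.
  apply: le_trans (costB_le p_gt0 M t t') _; rewrite tC tC'; lra.
- by rewrite combB tE tE' cE subrr.
Qed.

End SequentialNormingPair.

(** * The completion as a complete normed group, locally of l^1 type *)

Record complete_group_norm (R : realType) (C : topologicalZmodType)
    (nrm : C -> R) : Prop := {
  nrm0 : nrm 0 = 0 ;
  nrm_eq0 : forall x, nrm x = 0 -> x = 0 ;
  nrmN : forall x, nrm (- x) = nrm x ;
  nrmD : forall x y, nrm (x + y) <= nrm x + nrm y ;
  nrm_nbhs : forall (x : C) (U : set C),
    nbhs x U <-> exists2 e : R, 0 < e & [set y | nrm (x - y) < e] `<=` U ;
  nrm_complete : metric_complete (fun x y => nrm (x - y))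
}.

Section Completion.
Variables (R : realType) (V : zmodType) (G : set V) (sigma : V -> R).
Variables (C : topologicalZmodType) (d : C -> C -> R) (i : V -> C).
Hypotheses (G0 : G 0) (GB : forall x y, G x -> G y -> G (x - y)).
Hypothesis hC : is_completion G sigma d i.

Let hd := completion_metrizes hC.

Lemma dist_near (x : C) (e : R) : 0 < e -> nbhs x [set y | d x y < e].
Proof. by move=> e0; apply/(metrizes_nbhs hd); exists e. Qed.

Lemma completion_near (x : C) (e : R) : 0 < e ->
  exists2 g, G g & d x (i g) < e.
Proof.
move=> e0; have /nbhs_interior := dist_near x e0 => xU.
have [|y [/interior_subset/= xy [g Gg gE]]] :=
    completion_dense hC _ (open_interior [set y | d x y < e]).
  by exists x; exact: nbhs_singleton.
by exists g; rewrite ?gE.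
Qed.

Lemma dist_sub_near (x z : C) (e : R) : 0 < e -> exists2 h : R, 0 < h &
  forall x' z', d x x' < h -> d z z' < h -> d (x - z) (x' - z') < e.
Proof.
move=> e0.
have [[P Q] /= [/(metrizes_nbhs hd)[a a0 aP] /(metrizes_nbhs hd)[b b0 bQ]]] :=
  @sub_continuous C (x, z) _ (dist_near (x - z) e0).
move=> PQ; exists (Num.min a b); first by rewrite lt_min a0.
move=> x' z'; rewrite !lt_min => /andP[xa _] /andP[_ zb].
exact: (PQ (x', z') (conj (aP x' xa) (bQ z' zb))).
Qed.

Lemma dist_quad a b a' b' : `|d a b - d a' b'| <= d a a' + d b b'.
Proof.
have := metrizes_triangle hd a a' b; have := metrizes_triangle hd a' b' b.
have := metrizes_triangle hd a' a b'; have := metrizes_triangle hd a b b'.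
rewrite (metrizes_sym hd b' b) (metrizes_sym hd a' a) => *.
by rewrite ler_norml; apply/andP; split; lra.
Qed.

(** Invariance is clear on the image of [G], where distances are values of [sigma] at differences.
    Density and continuity of subtraction carry it over to [C]. *)
Lemma dist_translate x y z : d (x - z) (y - z) = d x y.
Proof.
apply/eqP; rewrite -subr_eq0 -normr_le0; apply/ler_addgt0Pr => e e0.
(* Four errors add up: the approximations of [x - z], [y - z], [x] and [y]. *)
have e40 : 0 < e / 4 by rewrite divr_gt0.
have [h h0 hP] := dist_sub_near x z e40.
have [k k0 kP] := dist_sub_near y z e40.
have m0 : 0 < Num.min (e / 4) (Num.min h k) by rewrite !lt_min e40 h0.
have [a Ga] := completion_near x m0.
have [b Gb] := completion_near y m0.
have [c Gc] := completion_near z m0.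
rewrite !lt_min => /and3P[_ zh zk] /and3P[ye _ yk] /and3P[xe xh _].
have E : d (i a - i c) (i b - i c) = d (i a) (i b).
  rewrite -!(completion_additive hC) // !(completion_isometry hC) //; last 2 first.
  - exact: GB.
  - exact: GB.
  by rewrite opprB addrA subrK.
have h1 := hP _ _ xh zh; have h2 := kP _ _ yk zk.
have q1 := dist_quad (x - z) (y - z) (i a - i c) (i b - i c).
have q2 := dist_quad (i a) (i b) x y.
rewrite E in q1; rewrite (metrizes_sym hd (i a) x) (metrizes_sym hd (i b) y) in q2.
have := ler_normD (d (x - z) (y - z) - d (i a) (i b)) (d (i a) (i b) - d x y).
rewrite addrA subrK; lra.
Qed.

Lemma dist_sub x y : d (x - y) 0 = d x y.
Proof. by rewrite -(subrr y) dist_translate. Qed.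

Lemma completion_norm : complete_group_norm (fun x => d x 0).
Proof.
have nN x : d (- x) 0 = d x 0 by rewrite -sub0r dist_sub (metrizes_sym hd).
split=> //.
- exact/(metrizes_eq0 hd).
- by move=> x /(metrizes_eq0 hd).
- move=> x y; rewrite -{1}[y]opprK dist_sub; apply: le_trans.
    exact: (metrizes_triangle hd _ 0).
  by rewrite (metrizes_sym hd 0) nN.
- move=> x U.
  under [X in ex2 _ X]eq_fun do
    under [X in X `<=` _]eq_set do rewrite dist_sub.
  exact: (metrizes_nbhs hd).
- move=> u uC; apply: (completion_complete hC) => e /uC[N hN].
  by exists N => m n mN nN'; rewrite -dist_sub hN.
Qed.

Lemma completion0 : i 0 = 0.
Proof. by have := completion_additive hC G0 G0; rewrite !subrr. Qed.

Lemma completion_normE x : G x -> d (i x) 0 = sigma x.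
Proof.
by move=> Gx; rewrite -completion0 (completion_isometry hC) // subr0.
Qed.

(** Additivity of [i] is known on [G] only, so membership in [G] is carried through the
    inductions. *)
Lemma completion_comb (v : nat -> V) m c : (forall j, G (v j)) ->
  i (comb v m c) = comb (i \o v) m c.
Proof.
move=> Gv.
have GN x : G x -> G (- x) by move=> Gx; rewrite -sub0r; exact: GB.
have GD x y : G x -> G y -> G (x + y).
  by move=> Gx Gy; rewrite -[y]opprK; apply: GB => //; exact: GN.
have iN x : G x -> i (- x) = - i x.
  by move=> Gx; rewrite -sub0r (completion_additive hC) // completion0 sub0r.
have iD x y : G x -> G y -> i (x + y) = i x + i y.
  move=> Gx Gy; rewrite -{1}[y]opprK (completion_additive hC) //; last exact: GN.
  by rewrite iN // opprK.
have in_ x n : G x -> G (x *+ n) /\ i (x *+ n) = i x *+ n.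
  move=> Gx; elim: n => [|n [Gn IH]]; first by rewrite !mulr0n completion0.
  by rewrite !mulrS iD // IH; split => //; exact: GD.
have iz x n : G x -> G (x *~ n) /\ i (x *~ n) = i x *~ n.
  move=> Gx; case: n => n; first exact: in_.
  have [Gn En] := in_ x n.+1 Gx.
  by rewrite !NegzE !mulrNz iN //= En; split => //; exact: GN.
suff [] : G (comb v m c) /\ i (comb v m c) = comb (i \o v) m c by [].
elim: m => [|m [Gm IH]]; first by rewrite /comb !big_ord0 completion0.
have [Gc Ec] := iz _ (c m) (Gv m).
by rewrite !combS iD // IH Ec; split => //; exact: GD.
Qed.

End Completion.

(** All that the topological arguments use: cheap combinations have norm equal to their cost, and
    every element is approximated by combinations whose cost nearly stays within its norm. *)
Record locally_ell1 (R : realType) (C : topologicalZmodType) (nrm : C -> R)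
    (w : nat -> C) (p : nat -> R) (rho : R) : Prop := {
  ell1_norm : complete_group_norm nrm ;
  ell1_gt0 : forall j, 0 < p j ;
  ell1_nonincreasing : nonincreasing_seq p ;
  ell1_cvg0 : p @ \oo --> 0 ;
  ell1_radius_gt0 : 0 < rho ;
  ell1_comb : forall m c, cost p m c < rho -> nrm (comb w m c) = cost p m c ;
  ell1_dense : forall z e, 0 < e ->
    exists m c, nrm (z - comb w m c) < e /\ cost p m c < nrm z + e
}.

Lemma SNP_completion_locally_ell1 (R : realType) (v p : nat -> R)
    (hSNP : SNP v p)
    (hgrowth : \forall j \near \oo,
       1 <= p j * (Num.floor (`|v j.+1| / `|v j| - 1))%:~R)
    (C : topologicalZmodType) (d : C -> C -> R) (i : R -> C)
    (hC : is_completion (SNP_group v) (SNP_sigma v p) d i) :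
  exists rho, locally_ell1 (fun x => d x 0) (i \o v) p rho.
Proof.
have [G0 GB] : SNP_group v 0 /\
    forall x y, SNP_group v x -> SNP_group v y -> SNP_group v (x - y).
  split=> [H [[]] //|x y Gx Gy H hH].
  by apply: (proj2 (proj1 hH)); [exact: Gx | exact: Gy].
have Gv j : SNP_group v (v j) by apply: sub_gen_smallest; exists j.
case: hgrowth => N _ hN.
have hd := completion_metrizes hC.
(* The two bounds required by [SNP_sigma_comb]. *)
exists (Num.min (p N) (1 / 2)); split.
- exact: completion_norm GB hC.
- exact: SNP_p_gt0 hSNP.
- exact: SNP_p_nonincreasing hSNP.
- exact: SNP_p_cvg0 hSNP.
- by rewrite lt_min (SNP_p_gt0 hSNP) divr_gt0.
- move=> m c cr; rewrite -(completion_comb G0 GB hC) //.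
  rewrite (completion_normE G0 hC); last exact: SNP_comb.
  apply: (SNP_sigma_comb hSNP hN _ _ cr).
    by rewrite ge_min lexx.
  by rewrite ge_min lexx orbT.
- move=> z e e0; have e20 : 0 < e / 2 by rewrite divr_gt0.
  have [g Gg zg] := completion_near hC z e20.
  (* As [g] is within [e / 2] of [z], its norm is below [d z 0 + e], and some expansion costs less
     than that. *)
  have [|m [c [gE cg]]] := @SNP_sigma_lt _ _ _ hSNP g (d z 0 + e) Gg.
    rewrite -(completion_normE G0 hC) //.
    have := metrizes_triangle hd (i g) z 0.
    rewrite (metrizes_sym hd (i g) z); lra.
  exists m, c; split=> //.
  rewrite (dist_sub GB hC) -(completion_comb G0 GB hC) // -gE.
  by apply: lt_trans zg _; lra.
Qed.

(** * Balls of a group norm, in the group and in its subspaces *)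

Section NormBalls.
Variables (R : realType) (C : topologicalZmodType) (nrm : C -> R).
Hypothesis hn : complete_group_norm nrm.

Lemma nrmB x y : nrm (x - y) = nrm (y - x).
Proof. by rewrite -(nrmN hn) opprB. Qed.

Lemma nrm_triangle y x z : nrm (x - z) <= nrm (x - y) + nrm (y - z).
Proof. by apply: le_trans (nrmD hn _ _); rewrite addrA subrK. Qed.

Lemma nrm_subr_le x y : nrm x <= nrm y + nrm (x - y).
Proof. by apply: le_trans (nrmD hn _ _); rewrite addrC subrK. Qed.

Lemma nrm_ge0 x : 0 <= nrm x.
Proof.
have := nrmD hn x (- x); rewrite subrr (nrm0 hn) (nrmN hn); lra.
Qed.

Lemma nbhs_nrm x (e : R) : 0 < e -> nbhs x [set y | nrm (x - y) < e].
Proof. by move=> e0; apply/(nrm_nbhs hn); exists e. Qed.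

Lemma open_nrm (A : set C) :
  (forall x, A x -> exists2 e : R, 0 < e & forall y, nrm (x - y) < e -> A y) ->
  open A.
Proof. by rewrite openE => h x /h[e e0 eA]; apply/(nrm_nbhs hn); exists e. Qed.

Lemma nbhs_nrm_sub (A : set C) (s : set_type A) (e : R) : 0 < e ->
  nbhs s [set t : set_type A | nrm (set_val s - set_val t) < e].
Proof.
move=> e0; exact: (@initial_continuous _ _ (@set_val _ A) s _ (nbhs_nrm _ e0)).
Qed.

Lemma nbhs_subP (A : set C) (s : set_type A) (W : set (set_type A)) :
  nbhs s W -> exists2 e : R, 0 < e &
    forall t, nrm (set_val s - set_val t) < e -> W t.
Proof.
rewrite nbhsE => -[B [oB sB] BW]; case: oB sB BW => O oO <- sO OW.
have /(nrm_nbhs hn)[e e0 eO] : nbhs (set_val s) O by exact: open_nbhs_nbhs.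
by exists e => // t /eO/OW.
Qed.

Lemma open_nrm_sub (A : set C) (W : set (set_type A)) :
  (forall s, W s -> exists2 e : R, 0 < e &
    forall t, nrm (set_val s - set_val t) < e -> W t) ->
  open W.
Proof.
rewrite openE => h s /h[e e0 eW].
by apply: filterS (nbhs_nrm_sub s e0) => t; exact: eW.
Qed.

End NormBalls.

Lemma frontier_clopen (X : topologicalType) (A : set X) :
  open A -> closed A -> frontier A = set0.
Proof.
move=> oA cA; rewrite /frontier -(proj1 (closure_id A) cA).
by rewrite (proj1 (interior_id A) oA) setDv.
Qed.

(** * Tails, and total disconnectedness of small balls *)

Section LocallyEll1.
Variables (R : realType) (C : topologicalZmodType) (nrm : C -> R).
Variables (w : nat -> C) (p : nat -> R) (rho : R).
Hypothesis hl : locally_ell1 nrm w p rho.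

Let hn := ell1_norm hl.
Let p_gt0 := ell1_gt0 hl.
Let rho0 := ell1_radius_gt0 hl.
Let nrm_comb := ell1_comb hl.

Lemma ell1_approx z (e : R) : 0 < e -> exists m c,
  [/\ supported m c, nrm (z - comb w m c) < e & cost p m c < nrm z + e].
Proof.
move=> e0; have [m [c [h1 h2]]] := ell1_dense hl z e0.
exists m, (truncate m c); rewrite comb_truncate // cost_truncate //.
by split=> //; exact: truncate_supported.
Qed.

(** The bound [rho / 2] keeps sums of two such combinations in the range where norm equals cost. *)
Definition tail (M : nat) : set C := [set z | exists m c,
  [/\ supported m c, forall j, (j < M)%N -> c j = 0,
      cost p m c < rho / 2 & z = comb w m c]].

(** Plays the role of vanishing of the first [M] coordinates, expressed by approximation without
    defining coordinates on [C]. *)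
Definition tail_closure (M : nat) : set C :=
  [set z | forall e : R, 0 < e -> exists2 a, tail M a & nrm (z - a) < e].

(** Close approximants of [z] can be taken of cost below [p M], which leaves no room for a nonzero
    coefficient before [M]. *)
Lemma tail_closure_small M z : nrm z < p M -> nrm z < rho / 2 ->
  tail_closure M z.
Proof.
move=> zp zr e e0.
have e'0 : 0 < Num.min e (Num.min (p M - nrm z) (rho / 2 - nrm z)).
  by rewrite !lt_min e0 !subr_gt0 zp.
have [m [c [sc]]] := ell1_approx z e'0; rewrite !lt_min => /and3P[ze _ _].
rewrite -ltrBlDl !lt_min => /and3P[_ cp cr].
exists (comb w m c) => //; exists m, c; split=> // [j jM|]; last lra.
have [jm|/sc//] := ltnP j m.
apply: (cost_lt_eq0 p_gt0 (m := m)) => //.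
have := ell1_nonincreasing hl (ltnW jM); lra.
Qed.

Lemma tail_closureN M z : tail_closure M z -> tail_closure M (- z).
Proof.
move=> h e /h[_ [m [c [sc c0 cr ->]]] zc].
exists (comb w m (fun j => - c j)); last by rewrite combN -opprD (nrmN hn).
exists m, (fun j => - c j); split=> //; first exact: supportedN.
  by move=> j /c0->; rewrite oppr0.
by rewrite costN.
Qed.

(** The sum of the approximants costs less than [rho], so its cost is its norm; closeness to [a + b]
    brings this back below [rho / 2]. *)
Lemma tail_closureD M a b : tail_closure M a -> tail_closure M b ->
  nrm (a + b) < rho / 2 -> tail_closure M (a + b).
Proof.
move=> ha hb abr e e0.
have e'0 : 0 < Num.min (e / 2) ((rho / 2 - nrm (a + b)) / 2).
  by rewrite lt_min !divr_gt0 ?subr_gt0.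
have [_ [m [c [sc c0 cr ->]]]] := ha _ e'0; rewrite lt_min => /andP[h1 h2].
have [_ [m' [c' [sc' c'0 cr' ->]]]] := hb _ e'0; rewrite lt_min => /andP[h3 h4].
pose k := maxn m m'.
have E : comb w k (c \+ c') = comb w m c + comb w m' c'.
  by rewrite combD (comb_widen _ sc) ?leq_maxl // (comb_widen _ sc') ?leq_maxr.
have cost_le : cost p k (c \+ c') <= cost p m c + cost p m' c'.
  rewrite -(cost_widen _ sc (leq_maxl m m')) -(cost_widen _ sc' (leq_maxr m m')).
  exact: costD_le.
have near : nrm (a + b - comb w k (c \+ c')) <=
    nrm (a - comb w m c) + nrm (b - comb w m' c').
  by rewrite E opprD addrACA (nrmD hn).
exists (comb w k (c \+ c')); last lra.
exists k, (c \+ c'); split=> //.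
- exact: supportedD.
- by move=> j jM; rewrite /= c0 // c'0.
rewrite -nrm_comb; last lra.
have := nrm_subr_le hn (comb w k (c \+ c')) (a + b).
rewrite (nrmB hn (comb _ _ _)); lra.
Qed.

Lemma nrm_add_tail m c h : supported m c -> cost p m c < rho / 2 ->
  tail m h -> nrm (comb w m c + h) = nrm (comb w m c) + nrm h.
Proof.
move=> sc cr [m' [c' [sc' c'0 cr' ->]]].
pose k := maxn m m'.
have cE := cost_widen p sc (leq_maxl m m').
have cE' := cost_widen p sc' (leq_maxr m m').
have E : cost p k (c \+ c') = cost p m c + cost p m' c'.
  rewrite costD ?cE ?cE' // => j.
  by have [/c'0|/sc] := ltnP j m; [right|left].
rewrite -(comb_widen w sc (leq_maxl m m')) -(comb_widen w sc' (leq_maxr m m')).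
have rho_gt0 := rho0; rewrite -combD !nrm_comb ?E ?cE ?cE' //; lra.
Qed.

(** A displacement shorter than [p M] is itself in the tail closure, so it preserves the condition.
    This makes the sets cut out by [tail_closure M] clopen inside small sets. *)
Lemma tail_closure_shift M x y z : nrm (y - z) < p M ->
  nrm (z - x) < rho / 2 -> nrm (y - z) < rho / 2 ->
  tail_closure M (y - x) -> tail_closure M (z - x).
Proof.
move=> yzp zx yz h.
have <- : (y - x) + (z - y) = z - x by rewrite addrC addrA subrK.
apply: tail_closureD => //.
  by apply: tail_closure_small; rewrite nrmB.
by rewrite addrC addrA subrK.
Qed.

(* If [x] is within [e] of a combination [g] of the first [M] generators, then
   moving by [h] in the [M]-th tail changes the norm of [g] by exactly [nrm h]:
   on a sphere such a move must be small. *)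
Lemma tail_closure_sphere x (e : R) : nrm x < rho / 2 -> 0 < e ->
  exists M, forall y, nrm y = nrm x -> tail_closure M (y - x) ->
    nrm (y - x) < e.
Proof.
move=> xr e0.
(* Three errors bound [nrm h] by [3 * e / 5], and a fourth leads back to [y - x]. The other term
   keeps the cost of [c] below [rho / 2]. *)
have e'0 : 0 < Num.min (e / 5) (rho / 2 - nrm x).
  by rewrite lt_min divr_gt0 ?subr_gt0.
have [m [c [sc]]] := ell1_approx x e'0; rewrite lt_min => /andP[xc _].
rewrite -ltrBlDl lt_min => /andP[_ cr].
exists m => y yx /(_ (e / 5))[|h th yh]; first by rewrite divr_gt0.
have {}cr : cost p m c < rho / 2 by lra.
have hE := nrm_add_tail sc cr th.
have h1 := nrm_subr_le hn (comb w m c + h) y.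
have h2 : nrm (comb w m c + h - y) <=
    nrm (comb w m c - x) + nrm (h - (y - x)).
  apply: le_trans (nrmD hn _ _).
  by rewrite addrACA opprB addKr.
have h3 := nrm_subr_le hn x (comb w m c).
have h4 := nrm_subr_le hn (y - x) h.
rewrite (nrmB hn (comb _ _ _) x) (nrmB hn h) in h2; lra.
Qed.

(** Take a combination [g] of the first [m] generators near [z] and an element [h] of the [m]-th
    tail near [- z]. Then [g + h] is near 0, yet its norm is [nrm g + nrm h]; so [g], and with it
    [z], is small. *)
Lemma tail_closure_cap z : nrm z < rho / 2 -> (forall M, tail_closure M z) ->
  z = 0.
Proof.
move=> zr hz; apply: (nrm_eq0 hn); apply/eqP; rewrite eq_le (nrm_ge0 hn) andbT.
apply/ler_addgt0Pr => e e0; rewrite add0r.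
have e'0 : 0 < Num.min (e / 3) (rho / 2 - nrm z).
  by rewrite lt_min divr_gt0 ?subr_gt0.
have [m [c [sc]]] := ell1_approx z e'0; rewrite lt_min => /andP[zc _].
rewrite -ltrBlDl lt_min => /andP[_ cr].
have {}cr : cost p m c < rho / 2 by lra.
have [|h th zh] := tail_closureN (hz m) (e := e / 3); first by rewrite divr_gt0.
have hE := nrm_add_tail sc cr th.
have h1 : nrm (comb w m c + h) <= nrm (comb w m c - z) + nrm (h - - z).
  by apply: le_trans (nrmD hn _ _); rewrite addrACA opprK addNr addr0.
rewrite (nrmB hn (comb _ _ _)) (nrmB hn h) in h1.
have h2 := nrm_subr_le hn z (comb w m c).
have h3 := nrm_ge0 hn h; lra.
Qed.

(** In a connected subset containing [x], the points [y] with [y - x] in [tail_closure M] form a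
    clopen part, hence everything. As [M] is arbitrary, [y = x]. *)
Lemma totally_disconnected_ball :
  totally_disconnected [set x : C | nrm x < rho / 4].
Proof.
have small x y : nrm x < rho / 4 -> nrm y < rho / 4 -> nrm (x - y) < rho / 2.
  by move=> xr yr; have := nrmD hn x (- y); rewrite (nrmN hn); lra.
move=> x xr; apply/seteqP; split=> [y|_ ->]; last exact: connected_component_refl.
case=> A [Ax AU cA] Ay /=.
apply/eqP; rewrite -subr_eq0; apply/eqP/tail_closure_cap.
  by apply: small => //; exact: AU.
move=> M.
pose e := Num.min (p M) (rho / 2).
have e0 : 0 < e by rewrite lt_min p_gt0 divr_gt0.
have shift y1 y2 : A y1 -> A y2 -> nrm (y1 - y2) < e ->
    tail_closure M (y1 - x) -> tail_closure M (y2 - x).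
  move=> A1 A2; rewrite lt_min => /andP[d1 d2].
  by apply: tail_closure_shift => //; apply: small => //; exact: AU.
pose B := [set y | A y /\ tail_closure M (y - x)].
have onbhd (P : set C) : open [set z | exists2 y, P y & nrm (y - z) < e].
  apply: (open_nrm hn) => z [y1 Py yz].
  exists (e - nrm (y1 - z)); first by rewrite subr_gt0.
  by move=> t zt; exists y1 => //; have := nrm_triangle hn z y1 t; lra.
suff BA : B = A by move: Ay; rewrite -BA => -[].
apply: cA.
- exists x; split=> //; rewrite subrr.
  by apply: tail_closure_small; rewrite (nrm0 hn) ?divr_gt0.
(* Relative openness is witnessed by the [e]-neighborhood of [B], relative closedness by the
   complement of that of [A] minus [B]. By [shift], neither neighborhood meets the other part of
   [A]. *)
- exists [set z | exists2 y, B y & nrm (y - z) < e]; first exact: onbhd.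
  apply/seteqP; split=> z [Az].
    by move=> hz; split=> //; exists z; rewrite ?subrr ?(nrm0 hn).
  by move=> [y1 [Ay1 hy1] yz]; split=> //; exact: (shift y1).
- exists (~` [set z | exists2 y, (A `\` B) y & nrm (y - z) < e]).
    by apply: open_closedC; exact: onbhd.
  apply/seteqP; split=> z [Az hz]; split=> //.
    move=> [y1 [Ay1 nBy1] yz]; apply: nBy1; split=> //.
    by apply: (shift z) => //; rewrite (nrmB hn).
  apply: contrapT => nz; apply: hz; exists z; rewrite ?subrr ?(nrm0 hn) //.
  by split=> // -[].
Qed.

(** * Dimension at most one: spheres are zero-dimensional *)

Lemma frontier_ball_sub (x : C) (r : R) :
  frontier [set y | nrm (x - y) < r] `<=` [set y | nrm (x - y) = r].
Proof.
move=> y [cy iy]; apply/eqP; rewrite eq_le; apply/andP; split.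
  apply/ler_addgt0Pr => e e0.
  have [z [/= xz yz]] := cy _ (nbhs_nrm hn y e0).
  by have := nrm_triangle hn z x y; rewrite (nrmB hn z y); lra.
rewrite leNgt; apply/negP => yr; apply: iy.
have e0 : 0 < r - nrm (x - y) by rewrite subr_gt0.
apply/(nrm_nbhs hn); exists (r - nrm (x - y)) => // z /= yz.
by have := nrm_triangle hn y x z; lra.
Qed.

(** Around [s], the tail condition cuts out clopen sets by [tail_closure_shift], and they are
    arbitrarily small by [tail_closure_sphere] applied to [s - x]. *)
Lemma ind_sphere (x : C) (r : R) (A : set C) : r < rho / 4 ->
  A `<=` [set y | nrm (x - y) = r] -> ind_lt 1 (set_type A).
Proof.
move=> rr Ar s W /(nbhs_subP hn)[e e0 eW]; have rho_gt0 := rho0.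
have val_r (t : set_type A) : nrm (set_val t - x) = r.
  by rewrite (nrmB hn); apply: Ar; exact: set_valP.
have small (t1 t2 : set_type A) : nrm (set_val t1 - set_val t2) < rho / 2.
  have := nrm_triangle hn x (set_val t1) (set_val t2).
  rewrite (nrmB hn x) !val_r; lra.
have [|M hM] := tail_closure_sphere (x := set_val s - x) _ e0.
  by rewrite val_r; lra.
pose V := [set t : set_type A | tail_closure M (set_val t - set_val s)].
have shift (t1 t2 : set_type A) : nrm (set_val t1 - set_val t2) < p M ->
    V t1 -> V t2.
  by move=> h; apply: tail_closure_shift.
have oV : open V.
  by apply: (open_nrm_sub hn) => t Vt; exists (p M) => // t' h; exact: shift Vt.
have cV : closed V.
  rewrite -[V]setCK; apply: open_closedC; apply: (open_nrm_sub hn) => t nVt.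
  exists (p M) => // t' h Vt'; apply: nVt; apply: shift Vt'.
  by rewrite (nrmB hn).
exists V; split=> //.
- by rewrite /V /= subrr; apply: tail_closure_small; rewrite (nrm0 hn) ?divr_gt0.
- move=> t Vt; apply: eW; rewrite (nrmB hn).
  have := hM (set_val t - x); rewrite !val_r opprB addrA subrK; exact.
- by rewrite /= (frontier_clopen oV cV) => -[t]; rewrite inE.
Qed.

Lemma ind_lt2 : ind_lt 2 C.
Proof.
move=> x U /(nrm_nbhs hn)[e e0 eU].
pose r := Num.min e (rho / 8).
have r0 : 0 < r by rewrite lt_min e0 divr_gt0.
exists [set y | nrm (x - y) < r]; split.
- apply: (open_nrm hn) => y /= yr; exists (r - nrm (x - y)).
    by rewrite subr_gt0.
  by move=> z yz; have := nrm_triangle hn y x z; lra.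
- by rewrite /= subrr (nrm0 hn).
- by move=> y /=; rewrite lt_min => /andP[h _]; exact: eU.
- apply: ind_sphere (@frontier_ball_sub x r).
  have rho_gt0 := rho0; have : r <= rho / 8 by rewrite ge_min lexx orbT.
  lra.
Qed.

(** * Dimension at least one: walks along successive generators *)

Lemma ell1_small (e : R) : 0 < e ->
  exists K, forall k, (K <= k)%N -> p k < e.
Proof.
move=> e0; have /cvgrPdist_lt/(_ _ e0)[K _ hK] := ell1_cvg0 hl.
exists K => k /hK /=.
by rewrite sub0r normrN gtr0_norm.
Qed.

Lemma nrm_generator k : p k < rho -> nrm (w k) = p k.
Proof.
move=> kr; rewrite -[w k]mulr1z -(comb1 w 1 (ltnSn k)) nrm_comb.
  by rewrite cost1 // normr1 mul1r.
by rewrite cost1 // normr1 mul1r.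
Qed.

(** Otherwise all multiples of [w k] would stay in [U], and the costs, being norms of points of [U],
    would stay below [rho / 2], against the Archimedean property. *)
Lemma last_step (U : set C) k c : U `<=` [set x | nrm x < rho / 2] ->
  p k < rho / 2 -> cost p k c < rho / 2 -> U (comb w k c) ->
  exists n : nat, [/\ U (comb w k c + w k *~ n),
    ~ U (comb w k c + w k *~ n.+1) & cost p k c + n%:R * p k < rho / 2].
Proof.
move=> Ur kr cr Uc; have rho_gt0 := rho0; apply: contrapT => none.
have all_in (n : nat) : U (comb w k c + w k *~ n) /\
    cost p k c + n%:R * p k < rho / 2.
  elim: n => [|n [Un costn]]; first by rewrite mulr0z addr0 mul0r addr0.
  have Un1 : U (comb w k c + w k *~ n.+1).
    by apply: contrapT => nU; apply: none; exists n.
  split=> //.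
  pose c' j := if j == k then Posz n.+1 else c j.
  have E : comb w k c = comb w k c'.
    by apply: eq_comb => j; rewrite /c' ltn_neqAle => /andP[/negbTE->].
  have Ec : cost p k c = cost p k c'.
    by apply: eq_cost => j; rewrite /c' ltn_neqAle => /andP[/negbTE->].
  have c'k : c' k = n.+1 by rewrite /c' eqxx.
  have costE : cost p k.+1 c' = cost p k c + n.+1%:R * p k.
    by rewrite costS -Ec c'k.
  (* One more step of length [p k] keeps the cost below [rho], so it is a norm; membership in [U]
     then sharpens the bound to [rho / 2]. *)
  rewrite -costE -nrm_comb.
    by rewrite combS c'k -E; exact: Ur.
  by rewrite costE -addn1 natrD mulrDl mul1r; lra.
have [n hn'] : exists n : nat, rho / 2 / p k < n%:R.
  by exists (Num.truncn (rho / 2 / p k)).+1; exact: truncnS_gt.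
have [_ h] := all_in n; rewrite ltr_pdivrMr // in hn'.
have := cost_ge0 p_gt0 k c; lra.
Qed.

(* Erdős's argument: a walk leaving [U] within [p k] at its [k]-th stage has
   bounded norm, hence converges, and its limit is in the frontier of [U]. *)
Lemma no_small_clopen (U : set C) : open U -> closed U -> U 0 ->
  ~ U `<=` [set x | nrm x < rho / 2].
Proof.
move=> oU cU U0 Ur; have rho_gt0 := rho0.
have rho20 : 0 < rho / 2 by rewrite divr_gt0.
have [K hK] := ell1_small rho20.
pose good k c := U (comb w k c) /\ cost p k c < rho / 2.
pose set_coef k (c : nat -> int) n := fun j => if j == k then n else c j.
have /choice[next nextP] (kc : nat * (nat -> int)) : exists n : int,
    good kc.1 kc.2 -> good kc.1.+1 (set_coef kc.1 kc.2 n) /\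
    ((K <= kc.1)%N -> exists2 z, ~ U z &
      nrm (comb w kc.1.+1 (set_coef kc.1 kc.2 n) - z) <= p kc.1).
  case: kc => k c /=.
  have combE n : comb w k.+1 (set_coef k c n) = comb w k c + w k *~ n.
    rewrite combS {2}/set_coef eqxx; congr (_ + _); apply: eq_comb => j.
    by rewrite /set_coef ltn_neqAle => /andP[/negbTE->].
  have costE n : cost p k.+1 (set_coef k c n) = cost p k c + `|n|%:~R * p k.
    rewrite costS {2}/set_coef eqxx; congr (_ + _); apply: eq_cost => j.
    by rewrite /set_coef ltn_neqAle => /andP[/negbTE->].
  have [g|ng] := pselect (good k c); last by exists 0 => /ng.
  (* Before stage [K] a generator may be too long for [last_step]; the coefficient 0 leaves the
     point unmoved. *)
  case: (leqP K k) => [Kk|_]; last first.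
    by exists 0 => _; rewrite /good combE costE mulr0z addr0 normr0 mul0r addr0.
  case: g => Uc cr; have [n [Un nUn costn]] := last_step Ur (hK _ Kk) cr Uc.
  exists n => _; rewrite /good combE costE; split=> // _.
  exists (comb w k c + w k *~ n.+1) => //.
  rewrite -addn1 PoszD mulrzDr addrA opprD addrA subrr sub0r mulr1z (nrmN hn).
  by rewrite nrm_generator //; have := hK _ Kk; lra.
pose f := fix f k := if k is j.+1 then set_coef j (f j) (next (j, f j))
  else fun=> 0.
(* Stage [j] sets coefficient [j] and later stages keep it, so [c] collects the final
   coefficients. *)
pose c j := f j.+1 j.
have fE k j : (j < k)%N -> f k j = c j.
  elim: k => [//|k IH]; rewrite ltnS leq_eqVlt => /orP[/eqP->//|jk].
  by rewrite /= /set_coef ltn_eqF // IH.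
have fgood k : good k (f k).
  elim: k => [|k IH]; last by have [] := nextP (k, f k) IH.
  by split; rewrite /comb /cost big_ord0.
have combE k : comb w k (f k) = comb w k c by apply: eq_comb => j; exact: fE.
have costE k : cost p k (f k) = cost p k c by apply: eq_cost => j; exact: fE.
have cost_lt k : cost p k c < rho / 2 by rewrite -costE; case: (fgood k).
have Uk k : U (comb w k c) by rewrite -combE; case: (fgood k).
have incr : nondecreasing_seq (fun k => cost p k c).
  by apply/nondecreasing_seqP => k; rewrite costS lerDl cost_term_ge0.
(* Distances along the walk are increments of a bounded monotone cost, so the walk is Cauchy. *)
have distE k l : (k <= l)%N ->
    nrm (comb w l c - comb w k c) = cost p l c - cost p k c.
  move=> kl.
  pose t j := c j - truncate k c j.
  have tE : cost p l t = cost p l c - cost p k c.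
    have -> : cost p l c = cost p l (t \+ truncate k c).
      by apply: eq_cost => j _; rewrite /= subrK.
    rewrite costD; first by rewrite (cost_truncate _ _ kl) addrK.
    by move=> j; rewrite /t /truncate; case: ifP; [left|right]; rewrite ?subrr.
  rewrite -(comb_truncate w c kl) -combB nrm_comb tE //.
  have := cost_lt l; have := cost_ge0 p_gt0 k c; lra.
have dist_sym k l : nrm (comb w k c - comb w l c) = `|cost p k c - cost p l c|.
  have [kl|/ltnW lk] := leqP k l.
    by rewrite (nrmB hn) distE // distrC ger0_norm // subr_ge0 incr.
  by rewrite distE // ger0_norm // subr_ge0 incr.
have cvgc : cvgn (fun k => cost p k c).
  apply: nondecreasing_is_cvgn => //.
  by exists (rho / 2) => _ [k _ <-]; exact: ltW.
have [l lim_l] : exists l : C, (fun k => comb w k c) @ \oo --> l.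
  apply: (nrm_complete hn) => e e0; have e20 : 0 < e / 2 by rewrite divr_gt0.
  have /cvgrPdist_lt/(_ _ e20)[N _ hN] := cvgc.
  exists N => a b aN bN; rewrite dist_sym.
  apply: le_lt_trans (ler_distD (limn (fun k => cost p k c)) _ _) _.
  by rewrite [`|cost p a c - _|]distrC [e]splitr ltrD // hN.
have Ul : U l.
  by apply: (closed_cvg U cU _ l lim_l); exact: nearW.
have /(nrm_nbhs hn)[e e0 eU] : nbhs l U by exact: open_nbhs_nbhs.
have e20 : 0 < e / 2 by rewrite divr_gt0.
have [N _ hN] := lim_l _ (nbhs_nrm hn l e20).
have [M hM] := ell1_small e20.
(* At this stage the walk is within [e / 2] of [l], and a point outside [U] lies within
   [p k < e / 2] of the walk. *)
pose k := maxn K (maxn N M).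
have [_ /(_ (leq_maxl _ _))[z nUz]] := nextP (k, f k) (fgood k).
rewrite -[set_coef _ _ _]/(f k.+1) combE /= => zk; apply: nUz; apply: eU => /=.
have h1 : nrm (l - comb w k.+1 c) < e / 2.
  by apply: hN; rewrite /= /k leqW // !leq_max leqnn orbT.
have h2 : p k < e / 2 by apply: hM; rewrite /k !leq_max leqnn !orbT.
have := nrm_triangle hn (comb w k.+1 c) l z; lra.
Qed.

(** Dimension zero would give a small open neighborhood of 0 with empty frontier, which is then also
    closed. *)
Lemma not_ind_lt1 : ~ ind_lt 1 C.
Proof.
have rho20 : 0 < rho / 2 by rewrite divr_gt0.
move=> /(_ 0 [set x | nrm (0 - x) < rho / 2] (nbhs_nrm hn 0 rho20)).
move=> [U [oU U0 Ur fU]]; apply: (no_small_clopen oU _ U0); last first.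
  by move=> x /Ur; rewrite /= sub0r (nrmN hn).
move=> x cx; apply: contrapT => nUx; apply: fU.
suff fx : frontier U x by exact: (SigSub (mem_set fx)).
by split=> //; rewrite (proj1 (interior_id U) oU).
Qed.

(** * Failure of local compactness *)

Lemma separated_sequence (e : R) : 0 < e -> e < rho ->
  exists y : nat -> C, exists K, (forall k, nrm (y k) < e) /\
    forall j k, (K <= j)%N -> (j < k)%N -> e / 2 <= nrm (y k - y j).
Proof.
move=> e0 er.
(* The largest multiple of [w k] of cost at most [e / 2]. Once [p k < e / 4] this cost exceeds
   [e / 4], and the costs for distinct generators add. *)
pose n k := Num.truncn (e / 2 / p k).
have n_le k : (n k)%:R * p k <= e / 2.
  by rewrite -ler_pdivlMr // truncn_le !divr_ge0 // ltW.
have n_gt k : e / 2 < (n k)%:R * p k + p k.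
  rewrite -[X in _ + X]mul1r -mulrDl natr1 -ltr_pdivrMr //; exact: truncnS_gt.
pose c k j := if j == k then Posz (n k) else 0.
have cost_c m k : (k < m)%N -> cost p m (c k) = (n k)%:R * p k.
  by move=> km; rewrite cost1 // normr_nat.
have e40 : 0 < e / 4 by rewrite divr_gt0.
have [K hK] := ell1_small e40.
exists (fun k => w k *~ n k), K; split=> [k|j k Kj jk].
  rewrite -(comb1 w (n k) (ltnSn k)) nrm_comb cost_c //; have := n_le k; lra.
rewrite -(comb1 w (n k) (ltnSn k)) -(comb1 w (n j) (leqW jk)) -combB.
have costE : cost p k.+1 (fun i => c k i - c j i) =
    (n k)%:R * p k + (n j)%:R * p j.
  rewrite -(cost_c k.+1 k) // -(cost_c k.+1 j) ?leqW // -[cost p _ (c j)]costN.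
  rewrite -costD // => i; rewrite /c.
  case: (eqVneq i j) => [->|_]; last by right; rewrite oppr0.
  by left; rewrite ltn_eqF.
rewrite nrm_comb costE; first last.
  by have := n_le k; have := n_le j; lra.
have := n_gt k; have := n_gt j; have := hK _ Kj.
have := hK _ (leq_trans Kj (ltnW jk)); lra.
Qed.

(** In a compact neighborhood the separated sequence would have a cluster point, with two late terms
    within [r / 4] of it and so less than [r / 2] apart. *)
Lemma not_locally_compact : ~ locally_compact [set: C].
Proof.
have rho_gt0 := rho0.
move=> /(_ 0 I)[A nA [cptA _]].
have /(nrm_nbhs hn)[e e0 eA] : nbhs 0 A.
  by apply: (filterS _ (nA : nbhs 0 _)) => x; exact.
pose r := Num.min e (rho / 2).
have r0 : 0 < r by rewrite lt_min e0 divr_gt0.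
have [|y [K [yr ysep]]] := separated_sequence r0.
  have : r <= rho / 2 by rewrite ge_min lexx orbT.
  lra.
have yA k : A (y k).
  apply: eA => /=; rewrite sub0r (nrmN hn).
  by have := yr k; rewrite lt_min => /andP[].
have [q [_ qy]] : A `&` cluster (y @ \oo) !=set0.
  by apply: cptA; exists 0%N => // k _; exact: yA.
have r40 : 0 < r / 4 by rewrite divr_gt0.
have often k : exists2 j, (k <= j)%N & nrm (q - y j) < r / 4.
  have tail_k : (y @ \oo) [set z | exists2 j, (k <= j)%N & z = y j].
    by exists k => // j kj; exists j.
  by have [z [[j kj ->] qz]] := qy _ _ tail_k (nbhs_nrm hn q r40); exists j.
have [j Kj qj] := often K; have [k jk qk] := often j.+1.
have := ysep _ _ Kj jk; have := nrm_triangle hn q (y k) (y j).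
rewrite (nrmB hn _ q); lra.
Qed.

End LocallyEll1.

(** * The three properties for the completion of the generated group *)

Theorem theorem4p3 (R : realType) (v p : nat -> R)
    (hSNP : SNP v p)
    (hgrowth : \forall j \near \oo,
       1 <= p j * (Num.floor (`|v j.+1| / `|v j| - 1))%:~R)
    (C : topologicalZmodType) (d : C -> C -> R) (i : R -> C)
    (hC : is_completion (SNP_group v) (SNP_sigma v p) d i) :
  [/\ has_ind C 1,
      locally_totally_disconnected C
    & ~ locally_compact [set: C] ].
Proof.
have [rho hl] := SNP_completion_locally_ell1 hSNP hgrowth hC.
split.
- by split; [exact: ind_lt2 hl | exact: not_ind_lt1 hl].
- exists [set x | d x 0 < rho / 4]; last exact: totally_disconnected_ball hl.
  apply/(metrizes_nbhs (completion_metrizes hC)); exists (rho / 4).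
    by rewrite divr_gt0 // (ell1_radius_gt0 hl).
  by move=> x /=; rewrite (metrizes_sym (completion_metrizes hC)).
- exact: not_locally_compact hl.
Qed.
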